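(* Let $1\le j<k$, let $p_1,\dots,p_k$ be distinct primes, and let $G=S_{p_1}\times\cdots\times S_{p_j}\times\mathbb{Z}_s$, where $S_{p_i}=\mathbb{Z}_{p_i^{e_i}}\times\mathbb{Z}_{p_i^{t_i}}$ with $1\le t_i\le e_i$ for $1\le i\le j$, and $s=\prod_{i=j+1}^{k}p_i^{e_i}$ with $e_{j+1},\dots,e_k\ge1$. A non-zero element $(a_1,a_2,\ldots,a_j,a_s)\in G$ is an isolated vertex in $\Gamma(G)$ if and only if $a_i$ is an isolated vertex of $\Gamma(S_{p_i})$ for some $i\in\{1,2,\ldots,j\}$. Explicitly, $$\mathcal{I}(G)=\bigcup_{i=1}^{j}S_{p_1}\times\cdots\times\mathcal{I}(S_{p_i})\times\cdots\times S_{p_j}\times\mathbb{Z}_s.$$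
   Context: The generating graph $\Gamma(G)$ of a group $G$ is the simple graph with vertex set $G$ in which two distinct vertices $x,y$ are adjacent if and only if $\langle x,y\rangle=G$. $\mathcal{I}(G)$ is the set of isolated vertices of $\Gamma(G)$. In the $i$-th member of the union, the factor $S_{p_i}$ is replaced by $\mathcal{I}(S_{p_i})$. *)

(* Defs.v *)
From HB Require Import structures.
From mathcomp Require Import all_boot all_order all_algebra all_fingroup.

Set Implicit Arguments.
Unset Strict Implicit.
Unset Printing Implicit Defensive.

Local Open Scope group_scope.

Definition gen_graph (gT : finGroupType) : rel gT :=
  fun x y => (x != y) && (<<[set x; y]>> == [set: gT]).

Lemma gen_graph_irr (gT : finGroupType) : irreflexive (@gen_graph gT).
Proof. by move=> x; rewrite /gen_graph eqxx. Qed.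

Lemma gen_graph_sym (gT : finGroupType) : symmetric (@gen_graph gT).
Proof. by move=> x y; rewrite /gen_graph eq_sym setUC. Qed.

Definition isolated (T : finType) (adj : rel T) (x : T) : bool :=
  [forall y, ~~ adj x y].

Definition isolated_vertices (gT : finGroupType) : {set gT} :=
  [set x | isolated (@gen_graph gT) x].

(* 'Z_n is the additive group of integers modulo n whenever n > 1 (it is
   integers modulo 2 for n <= 1). In group_scope its law, written
   multiplicatively, is the addition, and 1 is its zero element; the group
   structures on products are the componentwise ones. *)
Definition rank2_group (q e t : nat) : finGroupType :=
  ('Z_(q ^ e) * 'Z_(q ^ t))%type.

(* Indices start at 0: only the values p i, e i for i < k and t i for i < j
   matter, and the i-th noncyclic factor is rank2_group (p i) (e i) (t i). *)
Definition cyclic_order (j k : nat) (p e : nat -> nat) : nat :=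
  (\prod_(j <= i < k) p i ^ e i)%N.

Definition noncyclic_part (j : nat) (p e t : nat -> nat) : finGroupType :=
  {dffun forall i : 'I_j, rank2_group (p i) (e i) (t i)}.

Definition prod_group (j k : nat) (p e t : nat -> nat) : finGroupType :=
  (noncyclic_part j p e t * 'Z_(cyclic_order j k p e))%type.

(* Main.v *)
Require Import Defs.
From HB Require Import structures.
From mathcomp Require Import all_boot all_order all_algebra all_fingroup.
From mathcomp Require Import cyclic.

Set Implicit Arguments.
Unset Strict Implicit.
Unset Printing Implicit Defensive.

Local Open Scope group_scope.

(** A generating pair of [G] projects to generating pairs of all the factors.
    Conversely, if the components of two elements generate each factor, then the
    order of the subgroup they generate is divisible by the order of each
    factor; these orders being pairwise coprime, it is divisible by the order
    of [G]. The graphs ignore the pairs [(x, x)], which is harmless because the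
    rank 2 factors, hence [G], are not cyclic. *)

Lemma prod_coprime_dvdn (I : eqType) (r : seq I) (F : I -> nat) (m : nat) :
    uniq r -> {in r &, forall i l, i != l -> coprime (F i) (F l)} ->
    {in r, forall i, F i %| m} ->
  \prod_(i <- r) F i %| m.
Proof.
elim: r => [|i r IHr] /=; first by rewrite big_nil dvd1n.
case/andP=> i_notin_r uniq_r coF dvF; rewrite big_cons Gauss_dvd.
  rewrite dvF ?mem_head //= IHr // => [l l' lr l'r|l lr].
    by apply: coF; rewrite inE ?lr ?l'r orbT.
  by apply: dvF; rewrite inE lr orbT.
(* What remains is the side condition of [Gauss_dvd]: [F i] is coprime to the product over the tail,
   by multiplicativity of coprimality. *)
rewrite big_seq; elim/big_ind: _ => [|x y|l lr]; first exact: coprimen1.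
  by rewrite coprimeMr => -> ->.
apply: coF; rewrite ?inE ?eqxx ?lr ?orbT //.
by apply: contraNneq i_notin_r => ->.
Qed.

Section MorphGenPair.

Variables (aT rT : finGroupType) (f : aT -> rT).
Hypothesis fM : {morph f : x y / x * y}.

Let phi := @Morphism _ _ [set: aT] f (in2W fM).

Lemma morphim_gen_pair (x y : aT) :
  phi @* <<[set x; y]>> = <<[set f x; f y]>>.
Proof.
by rewrite morphim_gen ?subsetT // morphimEsub ?subsetT // imsetU1 imset_set1.
Qed.

(** The set-theoretic section [g] witnesses that [f] is surjective, so the image of the whole group
    is the whole of [rT]. *)
Lemma gen_pair_surj (g : rT -> aT) (x y : aT) :
    cancel g f -> <<[set x; y]>> = [set: aT] ->
  <<[set f x; f y]>> = [set: rT].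
Proof.
move=> gK genxy; rewrite -morphim_gen_pair genxy; apply/setP=> z.
by rewrite inE -(gK z) (mem_morphim phi) ?inE.
Qed.

(** The order of a morphic image divides the order of the subgroup mapped, and here the image is all
    of [rT]. *)
Lemma dvdn_card_gen_pair (x y : aT) :
  <<[set f x; f y]>> = [set: rT] -> #|rT| %| #|<<[set x; y]>>|.
Proof.
by move=> genfxy; rewrite -cardsT -genfxy -morphim_gen_pair dvdn_morphim.
Qed.

End MorphGenPair.

Lemma prime_exp_gt1 (q d : nat) : prime q -> (0 < d)%N -> (1 < q ^ d)%N.
Proof. by move=> q_pr d0; rewrite -(exp1n d) ltn_exp2r ?prime_gt1. Qed.

Lemma card_rank2_group (q e t : nat) :
    prime q -> (0 < e)%N -> (0 < t)%N ->
  #|rank2_group q e t| = (q ^ (e + t))%N.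
Proof.
move=> q_pr e0 t0.
by rewrite card_prod !card_ord !Zp_cast ?prime_exp_gt1 ?expnD.
Qed.

(** Since [t <= e], every element is killed by [q ^ e], whereas a generator would have order
    [q ^ (e + t)], which is larger because [t > 0]. *)
Lemma rank2_group_not_cyclic (q e t : nat) (x : rank2_group q e t) :
    prime q -> (0 < t <= e)%N ->
  <<[set x; x]>> != [set: rank2_group q e t].
Proof.
move=> q_pr /andP[t0 te]; have e0 := leq_trans t0 te.
apply/negP => /eqP genx.
have: #[x] = (q ^ (e + t))%N.
  by rewrite -card_rank2_group // orderE -cardsT -genx setUid.
have xq1 d (z : 'Z_(q ^ d)) : (0 < d <= e)%N -> z ^+ (q ^ e) = 1.
  case/andP=> d0 de; apply/eqP; rewrite -order_dvdn.
  apply: dvdn_trans (dvdn_exp2l q de).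
  have := order_dvdG (in_setT z).
  by rewrite cardsT card_ord Zp_cast ?prime_exp_gt1.
have xqe : x ^+ (q ^ e) = 1.
  have expE n : x ^+ n = (x.1 ^+ n, x.2 ^+ n).
    by elim: n => // n IHn; rewrite !expgS IHn.
  by rewrite expE !xq1 ?e0 ?t0 ?leqnn.
move=> ox; move/eqP: xqe; rewrite -order_dvdn ox dvdn_Pexp2l ?prime_gt1 //.
by rewrite -{2}[e]addn0 leq_add2l leqNgt t0.
Qed.

Lemma not_isolatedP (gT : finGroupType) (x : gT) :
  reflect (exists2 y, x != y & <<[set x; y]>> = [set: gT])
          (~~ isolated (@gen_graph gT) x).
Proof.
rewrite negb_forall; apply: (iffP existsP) => -[y].
  by rewrite negbK => /andP[xy /eqP]; exists y.
by move=> xy genxy; exists y; rewrite negbK /gen_graph xy genxy eqxx.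
Qed.

Section ProdGroup.

Variables (j k : nat) (p e t : nat -> nat).
Hypotheses (j_gt0 : (0 < j)%N) (lt_jk : (j < k)%N).
Hypothesis p_prime : forall i : nat, (i < k)%N -> prime (p i).
Hypothesis p_distinct :
  forall i l : nat, (i < k)%N -> (l < k)%N -> p i = p l -> i = l.
Hypothesis te_bounds : forall i : nat, (i < j)%N -> (1 <= t i <= e i)%N.
Hypothesis e_gt0 : forall i : nat, (j <= i < k)%N -> (1 <= e i)%N.

Let Sp (i : 'I_j) := rank2_group (p i) (e i) (t i).
Let s := cyclic_order j k p e.
Let G := prod_group j k p e t.

Let ord_ltk (i : 'I_j) : (i < k)%N := ltn_trans (ltn_ord i) lt_jk.

Lemma card_Sp (i : 'I_j) : #|Sp i| = (p i ^ (e i + t i))%N.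
Proof.
have /andP[t0 te] := te_bounds (ltn_ord i).
by rewrite card_rank2_group ?p_prime ?(leq_trans t0).
Qed.

Lemma coprime_p (i l : nat) : (i < k)%N -> (l < k)%N -> i != l ->
  coprime (p i) (p l).
Proof.
move=> ik lk il; rewrite prime_coprime ?dvdn_prime2 ?p_prime //.
by apply: contraNneq il => /p_distinct ->.
Qed.

(** Ensures that ['Z_s] really has [s] elements. As [j < k], the product contains the factor
    [p j ^ e j], which already exceeds 1. *)
Lemma cyclic_order_gt1 : (1 < s)%N.
Proof.
have pe_gt1 : (1 < p j ^ e j)%N.
  by rewrite prime_exp_gt1 ?p_prime ?e_gt0 ?leqnn.
rewrite /s /cyclic_order big_ltn //; apply: (leq_trans pe_gt1).
apply: leq_pmulr; rewrite big_nat; apply: prodn_cond_gt0 => i /andP[_ ik].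
by rewrite expn_gt0 prime_gt0 ?p_prime.
Qed.

Lemma coprime_Sp_cyclic_order (i : 'I_j) : coprime #|Sp i| s.
Proof.
rewrite card_Sp /s /cyclic_order big_nat.
elim/big_ind: _ => [|x y|l /andP[jl lk]]; first exact: coprimen1.
  by rewrite coprimeMr => -> ->.
rewrite coprimeXl ?coprimeXr ?coprime_p //.
by rewrite neq_ltn (leq_trans (ltn_ord i)).
Qed.

Lemma projM (i : 'I_j) : {morph (fun x : G => x.1 i) : x y / x * y}.
Proof. by move=> x y; exact: dffunM. Qed.

Lemma embK (i : 'I_j) :
  cancel (fun x : Sp i => (dfung1 x, 1) : G) (fun x : G => x.1 i).
Proof. by move=> x; exact: dfung1_id. Qed.

Lemma gen_prod_group (a b : G) :
    (forall i, <<[set a.1 i; b.1 i]>> = [set: Sp i]) ->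
    <<[set a.2; b.2]>> = [set: 'Z_s] ->
  <<[set a; b]>> = [set: G].
Proof.
move=> gen1 gen2; apply/eqP; rewrite eqEcard subsetT cardsT /=.
apply: dvdn_leq; first exact: cardG_gt0.
have dv1 i : #|Sp i| %| #|<<[set a; b]>>|.
  exact: dvdn_card_gen_pair (projM i) _ _ (gen1 i).
have dv2 : s %| #|<<[set a; b]>>|.
  have sndM : {morph (fun x : G => x.2) : x y / x * y} by [].
  have := dvdn_card_gen_pair sndM gen2.
  by rewrite card_ord Zp_cast ?cyclic_order_gt1.
have -> : #|G| = (\prod_(i <- index_enum 'I_j) #|Sp i| * s)%N.
  rewrite card_prod card_ord Zp_cast ?cyclic_order_gt1 //; congr (_ * _)%N.
  (* The dependent functions are counted as the product [setXn] of the full sets, to which [cardsXn]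
     applies. *)
  rewrite -cardsT -(eq_bigr _ (fun i _ => cardsT (Sp i))) -cardsXn.
  by apply: eq_card => x; rewrite inE; apply/esym/setXnP => i; rewrite inE.
rewrite Gauss_dvd ?dv2 ?andbT.
  apply: prod_coprime_dvdn => [|i l _ _ il|i _]; first exact: index_enum_uniq.
    by rewrite !card_Sp coprimeXl ?coprimeXr ?coprime_p.
  exact: dv1.
elim/big_ind: _ => [|x y|i _]; first exact: coprime1n.
  by rewrite coprimeMl => -> ->.
exact: coprime_Sp_cyclic_order.
Qed.

Lemma isolated_prod_group (a : G) :
  isolated (@gen_graph G) a = [exists i, isolated (@gen_graph (Sp i)) (a.1 i)].
Proof.
apply/idP/existsP => [|[i]]; last first.
  apply: contraLR => /not_isolatedP[b _ genab]; apply/not_isolatedP.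
  have geni : <<[set a.1 i; b.1 i]>> = [set: Sp i].
    exact (gen_pair_surj (projM i) (@embK i) genab).
  (* Equal components would make [Sp i] cyclic, so [b.1 i] is a genuine neighbour of [a.1 i]. *)
  exists (b.1 i) => //; apply/eqP=> abi; move: geni; rewrite -abi; apply/eqP.
  by rewrite rank2_group_not_cyclic ?te_bounds ?p_prime.
move=> iso_a; apply/existsP; apply: contraLR iso_a.
rewrite negb_exists => /forallP niso.
have /fin_all_exists2[y ay geny] i := not_isolatedP _ (niso i).
(* The neighbour of [a] joins the chosen neighbours of its components with [Zp1], which generates
   ['Z_s] by itself, whatever [a.2] is. *)
apply/not_isolatedP; exists (finfun y : noncyclic_part j p e t, Zp1 : 'Z_s).
  (* The two vertices already differ at index 0, which exists because [j > 0]. *)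
  apply: contraNneq (ay (Ordinal j_gt0)) => ->.
  by rewrite /= ffunE.
apply: gen_prod_group => [i|] /=; first by rewrite ffunE geny.
have genZ : [set: 'Z_s] = <[Zp1 : 'Z_s]> by exact: Zp_cycle.
apply/eqP; rewrite eqEsubset subsetT genZ cycle_subG.
by rewrite mem_gen // !inE eqxx orbT.
Qed.

End ProdGroup.

Theorem proposition5p5 (j k : nat) (p e t : nat -> nat)
    (j_gt0 : (0 < j)%N) (lt_jk : (j < k)%N)
    (p_prime : forall i : nat, (i < k)%N -> prime (p i))
    (p_distinct : forall i l : nat, (i < k)%N -> (l < k)%N -> p i = p l -> i = l)
    (te_bounds : forall i : nat, (i < j)%N -> (1 <= t i <= e i)%N)
    (e_gt0 : forall i : nat, (j <= i < k)%N -> (1 <= e i)%N) :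
  let Sp := fun i : 'I_j => rank2_group (p i) (e i) (t i) in
  let G := prod_group j k p e t in
  (forall a : G, a != 1 ->
     isolated (@gen_graph G) a <->
     exists i : 'I_j, isolated (@gen_graph (Sp i)) (a.1 i)) /\
  isolated_vertices G =
    \bigcup_(i < j)
      setX (setXn (dfwith (fun l : 'I_j => [set: Sp l])
                          (isolated_vertices (Sp i))))
           [set: 'Z_(cyclic_order j k p e)].
Proof.
move=> Sp G; have isoE := isolated_prod_group j_gt0 lt_jk p_prime p_distinct
  te_bounds e_gt0.
split=> [a _|]; first by rewrite isoE; split=> /existsP.
apply/setP=> -[a1 a2]; rewrite inE isoE; apply/existsP/bigcupP => -[i].
  move=> iso_i; exists i => //; rewrite in_setX in_setT andbT.
  (* [dfwithP] separates the index [i], where the factor is the set of isolated vertices, from the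
     others, where it is the full group. *)
  by apply/setXnP=> l; case: dfwithP => [|m _]; rewrite inE.
move=> _; rewrite in_setX in_setT andbT => /setXnP/(_ i).
by rewrite dfwith_in inE; exists i.
Qed.
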